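(* Let $A$ be a Hausdorff abelian topological group such that $\alpha_A$ is injective, and let $K\le A$ be a compact subgroup. Then: (a) $\alpha_{A/K}$ is injective; (b) $\alpha_{A/K}$ is surjective if and only if $\alpha_A$ is surjective; (c) $\alpha_{A/K}$ is an isomorphism of topological groups if and only if $\alpha_A$ is.
   Context: $\mathbb{T}=\mathbb{R}/\mathbb{Z}$. For an abelian topological group $B$, $\hat B$ is the group of continuous homomorphisms $B\to\mathbb{T}$ with the compact-open topology, and $\alpha_B\colon B\to\hat{\hat B}$ is the evaluation homomorphism $\alpha_B(b)(\chi)=\chi(b)$. $A/K$ carries the quotient topology. *)

(* Defs.v *)
From HB Require Import structures.
From mathcomp Require Import all_boot all_order all_algebra generic_quotient.
From mathcomp Require Import all_classical all_reals all_analysis.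
From mathcomp Require Import Rstruct Rstruct_topology.
Set Implicit Arguments. Unset Strict Implicit. Unset Printing Implicit Defensive.
Import Order.TTheory GRing.Theory Num.Theory.
Local Open Scope classical_set_scope.
Local Open Scope ring_scope.
Local Open Scope quotient_scope.

Record subgroup (A : zmodType) := Subgroup {
  sg_set : set A;
  sg_0 : sg_set 0;
  sg_sub : forall x y, sg_set x -> sg_set y -> sg_set (x - y) }.

Section Quotient.
Variables (A : PreTopologicalZmodule.type) (K : subgroup A).

Definition coset_rel : rel A := fun x y => `[< sg_set K (x - y) >].

Lemma coset_refl : reflexive coset_rel.
Proof. by move=> x; apply/asboolP; rewrite subrr; exact: sg_0. Qed.

Lemma coset_sym : symmetric coset_rel.
Proof.
suff H : forall x y, coset_rel x y -> coset_rel y x.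
  by move=> x y; apply/idP/idP; apply: H.
move=> x y /asboolP Kxy; apply/asboolP.
by have := sg_sub (sg_0 K) Kxy; rewrite sub0r opprB.
Qed.

Lemma coset_trans : transitive coset_rel.
Proof.
move=> y x z /asboolP Kxy /asboolP Kyz; apply/asboolP.
have Kzy : sg_set K (z - y) by have := sg_sub (sg_0 K) Kyz; rewrite sub0r opprB.
by have := sg_sub Kxy Kzy; rewrite opprB addrA subrK.
Qed.

Canonical coset_equiv := EquivRel coset_rel coset_refl coset_sym coset_trans.

Definition quot_car := {eq_quot coset_equiv}.

Definition quot : Type := quotient_topology quot_car.
HB.instance Definition _ := Choice.copy quot (quotient_topology quot_car).
HB.instance Definition _ := Topological.copy quot (quotient_topology quot_car).

Local Notation pi := (\pi_quot_car : A -> quot_car).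

Lemma piP x y : pi x = pi y <-> sg_set K (x - y).
Proof.
split; first by move=> /eqP; rewrite eqmodE => /asboolP.
by move=> Kxy; apply/eqmodP/asboolP.
Qed.

Definition qzero : quot := pi 0.
Definition qopp (a : quot) : quot := pi (- repr (a : quot_car)).
Definition qadd (a b : quot) : quot := pi (repr (a : quot_car) + repr (b : quot_car)).

Lemma repr_pi x : sg_set K (repr (pi x) - x).
Proof. by apply/piP; rewrite reprK. Qed.

Lemma qaddA : associative qadd.
Proof.
move=> a b c; rewrite /qadd; apply/piP.
set x := repr (a : quot_car); set y := repr (b : quot_car); set z := repr (c : quot_car).
have h1 := repr_pi (y + z); have h2 := repr_pi (x + y).
have := sg_sub h1 h2.
set r1 := repr (pi (y + z)); set r2 := repr (pi (x + y)).
suff -> : r1 - (y + z) - (r2 - (x + y)) = x + r1 - (r2 + z) by [].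
rewrite !opprD !opprK !addrA.
rewrite [r1 - y - z - r2 + x]addrC !addrA. rewrite [RHS]addrAC.
by rewrite addrAC [_ - z + y]addrAC subrK.
Qed.

Lemma qaddC : commutative qadd.
Proof. by move=> a b; rewrite /qadd addrC. Qed.

Lemma qadd0 : left_id qzero qadd.
Proof.
move=> a; rewrite /qadd /qzero -[RHS]reprK; apply/piP.
by rewrite addrK; have := repr_pi 0; rewrite subr0.
Qed.

Lemma qaddN : left_inverse qzero qopp qadd.
Proof.
move=> a; rewrite /qadd /qopp /qzero; apply/piP.
by rewrite subr0 -[X in _ + X]opprK; exact: repr_pi.
Qed.

HB.instance Definition _ := GRing.isZmodule.Build quot qaddA qaddC qadd0 qaddN.

End Quotient.

Unset Implicit Arguments.

Definition intsub : subgroup Rdefinitions.R^o.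
Proof.
refine (@Subgroup Rdefinitions.R^o [set x : Rdefinitions.R^o | x \is a Num.int] _ _).
- by rewrite /= rpred0.
- by move=> x y /= hx hy; rewrite rpredB.
Defined.

Definition Tcirc : Type := quot intsub.

Definition is_char (X : PreTopologicalZmodule.type)
  : set {compact-open, X -> Tcirc} :=
  [set f | (forall x y, f (x + y) = f x + f y) /\ continuous f].

Definition dual (X : PreTopologicalZmodule.type) : topologicalType :=
  set_type (@is_char X).

Definition alpha (X : PreTopologicalZmodule.type) (x : X)
  : {compact-open, dual X -> Tcirc} :=
  fun chi => set_val chi x.

(** The double dual: continuous homomorphisms (dual X) -> T, where the group
    law of dual X is pointwise addition of characters; it is a subspace of
    {compact-open, dual X -> T}. *)
Definition bidual (X : PreTopologicalZmodule.type)
  : set {compact-open, dual X -> Tcirc} :=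
  [set psi | (forall c1 c2 c3 : dual X,
                (forall x, set_val c3 x = set_val c1 x + set_val c2 x) ->
                psi c3 = psi c1 + psi c2)
             /\ continuous (psi : dual X -> Tcirc)].

Definition alpha_surjective (X : PreTopologicalZmodule.type) : Prop :=
  bidual X `<=` range (@alpha X).

(** alpha_X is an isomorphism of topological groups X -> bidual X:
    a bijection onto bidual X, continuous, with continuous inverse
    (i.e. open onto its image, for the subspace topology of bidual X).
    (alpha_X is always a group homomorphism.) *)
Definition alpha_topiso (X : PreTopologicalZmodule.type) : Prop :=
  [/\ injective (@alpha X),
      range (@alpha X) = bidual X,
      continuous (@alpha X)
    & forall U : set X, open U ->
        exists V : set {compact-open, dual X -> Tcirc},
          open V /\ (@alpha X) @` U = V `&` bidual X].

(* Main.v *)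
Require Import Defs.
From HB Require Import structures.
From mathcomp Require Import all_boot all_order all_algebra generic_quotient.
From mathcomp Require Import all_classical all_reals all_analysis.
From mathcomp Require Import Rstruct Rstruct_topology.
From mathcomp Require Import complex ring lra.
Set Implicit Arguments. Unset Strict Implicit. Unset Printing Implicit Defensive.
Import Order.TTheory GRing.Theory Num.Theory.
Import ComplexField.Normc.
Import numFieldNormedType.Exports.
                                                   
Import mathcomp.analysis.trigo.
Local Open Scope classical_set_scope.
Local Open Scope ring_scope.
Local Open Scope complex_scope.

                                                                          
                                                        

                                                                          
                                                                         
                                                                             
                                                                        
                                                                            
                                                

                                                             
                                                                               
                                                                               
                                                                            
                                                                         
                                               

                                                                        
                                                                            
                                                                             
                                                                      
                

                                         

(** Composition with [A -> A/K] identifies the dual of [A/K] with the annihilator of [K] in the dual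
    of [A]. Since [K] is compact and the circle has no small subgroups, this annihilator is open
    ([agree_nbhs]); since compact sets of [A/K] have compact preimages ([proj_preimage_compact]),
    the identification is a homeomorphism ([push_continuous], [pull_continuous]). Hence a compact
    set of characters of [A] lies in finitely many translates of a compact set of characters of
    [A/K] ([compact_dual_cover]).

    The second pillar is a quantitative Kronecker theorem ([kronecker], [dual_kronecker]). Values
    prescribed on finitely many characters of [A] are approximated at a point of [K] as soon as
    finitely many integer relations valid on [K] hold for these values up to chord 1/2, and the list
    of relations does not depend on the values. With compactness of [K], every algebraic
    homomorphism from the dual of [A] to the circle that vanishes on the annihilator is evaluation
    at a point of [K] ([ann_eval]).

    For (a), a point [x] of [A] killed by all characters of [A/K] induces such a homomorphism, so
    [x] agrees with some [k] in [K] on all characters, and [x = k]. For (b), an element of the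
    bidual of [A] is corrected by a point of [K] in one direction; in the other, a homomorphism on
    the annihilator is extended by divisibility of the circle, and the extension is continuous
    because the annihilator is open. For (c), [alpha_topisoP] splits a topological isomorphism into
    injectivity, surjectivity, equicontinuity of compact sets of characters, and polars of such sets
    forming a base at 0; the last two conditions are transferred separately, by [compact_dual_cover]
    and [dual_kronecker]. *)

(** * Complex modulus and a quantitative Kronecker theorem *)

Section ComplexNorm.
Variable R : realType.
Implicit Types (z w : R[i]).

Lemma normc_ge0 z : 0 <= normc z.
Proof. by case: z => a b /=; rewrite sqrtr_ge0. Qed.

Lemma normcD z w : normc (z + w) <= normc z + normc w.
Proof. exact: (@le_normcD R). Qed.

Lemma normcB z w : normc (z - w) <= normc z + normc w.
Proof. by rewrite -(normcN w) normcD. Qed.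

Lemma normc_real (r : R) : normc r%:C = `|r|.
Proof. by rewrite /= expr0n addr0 sqrtr_sqr. Qed.

Lemma normcX z n : normc (z ^+ n) = normc z ^+ n.
Proof.
by elim: n => [|n IH]; rewrite ?expr0 ?normc1// !exprS normcM IH.
Qed.

Lemma normc_sum (I : Type) (s : seq I) (P : pred I) (F : I -> R[i]) :
  normc (\sum_(i <- s | P i) F i) <= \sum_(i <- s | P i) normc (F i).
Proof.
elim/big_rec2: _ => [|i y x _ h]; first by rewrite normc0.
by apply: le_trans (normcD _ _) _; rewrite lerD2l.
Qed.

Lemma sqr_normc_parallelogram z :
  normc z = 1 -> normc (1 + z) ^+ 2 = 4 - normc (z - 1) ^+ 2.
Proof.
case: z => a b /= h.
have : a ^+ 2 + b ^+ 2 = 1.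
  by rewrite -(@sqr_sqrtr _ (a ^+ 2 + b ^+ 2)) ?h ?expr1n// addr_ge0 ?sqr_ge0.
rewrite !sqr_sqrtr ?addr_ge0 ?sqr_ge0// => h'.
by rewrite add0r oppr0 addr0; nra.
Qed.
End ComplexNorm.

                                                                            
                                                                   
(** Averaging over the translates [x + h *+ l] keeps the constant term and the bound [M], while a
    character with [X j h != 1] is damped to any size by the geometric sum. Induction removes the
    characters one at a time, the others surviving with new coefficients. *)
Lemma constant_term_le (R : realType) (A : zmodType) (K : set A)
    (J : eqType) (s : seq J) (c : J -> R[i]) (X : J -> A -> R[i]) c0 M :
  K 0 -> (forall x y, K x -> K y -> K (x + y)) ->
  (forall j x y, X j (x + y) = X j x * X j y) ->
  (forall j x, normc (X j x) = 1) ->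
  (forall j, j \in s -> exists2 h, K h & X j h != 1) ->
  (forall x, K x -> normc (c0 + \sum_(j <- s) c j * X j x) <= M) ->
  normc c0 <= M.
Proof.
move=> K0 KD XD X1.
elim: s c M => [|j s IH] c M Xn hM.
  by have := hM 0 K0; rewrite big_nil addr0.
have [h Kh hh] := Xn j (mem_head _ _).
apply/ler_addgt0Pr => eps eps0.
have d0 : 0 < normc (X j h - 1).
  rewrite lt_neqAle normc_ge0 andbT eq_sym; apply: contra hh => /eqP/eq0_normc.
  by move=> /eqP; rewrite subr_eq0.
(* The geometric sum has modulus at most [2 / normc (X j h - 1)], so this [N] makes the averaged
   [j]-th term at most [eps]. *)
have [N hN] : exists N : nat, 2 * normc (c j) / normc (X j h - 1) / eps < N.+1%:R.
  exists (Num.truncn (2 * normc (c j) / normc (X j h - 1) / eps)).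
  exact: truncnS_gt.
pose av i := (N.+1%:R)^-1 * \sum_(l < N.+1) X i h ^+ l.
have Xh i l : X i (h *+ l) = X i h ^+ l.
  elim: l => [|l IHl]; last by rewrite mulrS XD IHl exprS.
  rewrite mulr0n expr0; have := XD i 0 0; rewrite addr0 => e.
  have : X i 0 != 0.
    by apply/eqP => e0; have := X1 i 0; rewrite e0 normc0 => /eqP; rewrite eq_sym oner_eq0.
  by move=> /mulIf; apply; rewrite mul1r -e.
have Khl l : K (h *+ l) by elim: l => [|l IHl]; rewrite ?mulr0n ?mulrS//; exact: KD.
have Nn0 : N.+1%:R != 0 :> R[i] by rewrite pnatr_eq0.
apply: (IH (fun i => c i * av i)) => [i si|x Kx].
  by apply: Xn; rewrite in_cons si orbT.
have -> : c0 + \sum_(i <- s) c i * av i * X i x =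
    (N.+1%:R)^-1 * \sum_(l < N.+1) (c0 + \sum_(i <- j :: s) c i * X i (x + h *+ l))
    - c j * av j * X j x.
  rewrite big_split/= mulrDr sumr_const card_ord -[c0 *+ _]mulr_natl mulKf//.
  rewrite -[LHS]addr0 -!addrA; congr (c0 + _).
  rewrite exchange_big/= big_cons mulrDr.
  have E i : (N.+1%:R)^-1 * \sum_(l < N.+1) c i * X i (x + h *+ l) = c i * av i * X i x.
    rewrite /av !mulr_sumr mulr_suml; apply: eq_bigr => l _.
    by rewrite XD Xh; ring.
  rewrite E addr0 addrC addrA [- _ + _]addrC subrr add0r mulr_sumr.
  by apply: eq_bigr => i _; rewrite E.
apply: le_trans (normcB _ _) _; apply: lerD.
  rewrite normcM normcV.
  have -> : normc (N.+1%:R : R[i]) = N.+1%:R.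
    by rewrite -(rmorph_nat (real_complex R)) normc_real normr_nat.
  rewrite mulrC ler_pdivrMr ?ltr0n//.
  apply: le_trans (normc_sum _ _ _) _.
  rewrite mulr_natr -[X in _ *+ X](card_ord N.+1) -sumr_const.
  by apply: ler_sum => l _; apply: hM; apply: KD.
rewrite !normcM X1 mulr1 normcV.
have -> : normc (N.+1%:R : R[i]) = N.+1%:R.
  by rewrite -(rmorph_nat (real_complex R)) normc_real normr_nat.
have /(congr1 (@normc R)) : X j h ^+ N.+1 - 1 = _ := subrX1 (X j h) N.+1.
rewrite normcM => eqg.
have : normc (X j h - 1) * normc (\sum_(i < N.+1) X j h ^+ i) <= 2.
  rewrite -eqg; apply: le_trans (normcB _ _) _.
  by rewrite normcX X1 expr1n normc1; lra.
move: hN d0; set d := normc (X j h - 1); set S := normc (\sum_(i < _) _).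
set a := normc (c j) => hN d0 hS.
have Sd : S <= 2 / d by rewrite ler_pdivlMr// mulrC.
rewrite [_^-1 * S]mulrC mulrA ler_pdivrMr ?ltr0n// [eps * _]mulrC -ler_pdivrMr//.
apply: le_trans (ltW hN); rewrite ler_pM2r ?invr_gt0//.
rewrite [2 * a]mulrC -mulrA; apply: ler_wpM2l => //; exact: normc_ge0.
Qed.

(** Write [r] as the square of [s = Num.sqrt r]: one power [s ^+ k] absorbs one factor [k + 1],
    since [(k + 1) s^k] is at most the geometric sum of [s], and the other is left to the
    induction. *)
Lemma polynomial_mul_geometric_bounded (R : realType) n (r : R) :
  0 <= r -> r < 1 -> exists2 C, 0 <= C & forall k, (k.+1)%:R ^+ n * r ^+ k <= C.
Proof.
elim: n r => [|n IH] r r0 r1.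
  by exists 1 => // k; rewrite expr0 mul1r exprn_ile1// ltW.
have s0 := sqrtr_ge0 r.
have s1 : Num.sqrt r < 1 by rewrite -[ltRHS]sqrtr1 ltr_sqrt.
have [C C0 hC] := IH _ s0 s1.
have B k : (k.+1)%:R * Num.sqrt r ^+ k <= (1 - Num.sqrt r)^-1.
  rewrite -[leRHS]mul1r ler_pdivlMr ?subr_gt0//.
  apply: (@le_trans _ _ ((1 - Num.sqrt r) * \sum_(i < k.+1) Num.sqrt r ^+ i)).
    rewrite mulrC; apply: ler_wpM2l; first by rewrite subr_ge0 ltW.
    rewrite mulr_natl -[X in _ *+ X](card_ord k.+1) -sumr_const.
    by apply: ler_sum => i _; rewrite ler_wiXn2l// ?ltW// -ltnS.
  by have := subrX1 (Num.sqrt r) k.+1; have := exprn_ge0 k.+1 s0; lra.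
exists (C * (1 - Num.sqrt r)^-1).
  by rewrite mulr_ge0// invr_ge0 subr_ge0 ltW.
move=> k; rewrite -{1}(sqr_sqrtr r0) -exprM mul2n -addnn exprD exprSr.
have -> (a b c : R) : a * b * (c * c) = (a * c) * (b * c) by ring.
by apply: ler_pM => //; rewrite mulr_ge0 ?exprn_ge0.
Qed.

(** The bound for exponent [n + 1] leaves a spare factor [1 / (k + 1)]. *)
Lemma polynomial_mul_geometric_small (R : realType) n (r e : R) :
  0 <= r -> r < 1 -> 0 < e -> exists k, (k.+1)%:R ^+ n * r ^+ k < e.
Proof.
move=> r0 r1 e0; have [C C0 hC] := @polynomial_mul_geometric_bounded R n.+1 r r0 r1.
exists (Num.truncn (C / e)); set k := Num.truncn _.
have : C / e < k.+1%:R := truncnS_gt _.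
rewrite ltr_pdivrMr// => hk.
rewrite -(ltr_pM2l (_ : 0 < k.+1%:R)) ?ltr0n//.
by rewrite mulrA -exprS; apply: le_lt_trans (hC k) hk.
Qed.

Section Kronecker.
Variables (R : realType) (A T : zmodType) (e : T -> R[i]).
Hypotheses (eD : forall s t, e (s + t) = e s * e t)
  (e_norm : forall t, normc (e t) = 1) (e_inj : forall t, e t = 1 -> t = 0).
Variables (K : set A) (K0 : K 0) (KD : forall x y, K x -> K y -> K (x + y)).
Variables (I : finType) (o : I) (chi : I -> A -> T).
Hypotheses (chiD : forall i x y, chi i (x + y) = chi i x + chi i y)
  (chi0 : forall x, chi o x = 0).

Let e0 : e 0 = 1.
Proof.
have := eD 0 0; rewrite addr0 => h.
have nz : e 0 != 0.
  by apply/eqP => z; have := e_norm 0; rewrite z normc0 => /eqP; rewrite eq_sym oner_eq0.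
by apply: (mulIf nz); rewrite mul1r -h.
Qed.

Let eVK t : e t * e (- t) = 1. Proof. by rewrite -eD subrr e0. Qed.

Definition comb N (u : I -> T) (p : {ffun I -> 'I_N}) : T := \sum_i u i *+ p i.

Lemma sum_count k (u : I -> T) (g : {ffun 'I_k -> I}) :
  \sum_j u (g j) = \sum_i u i *+ #|[pred j | g j == i]|.
Proof.
rewrite (partition_big g predT)//=; apply: eq_bigr => i _.
by rewrite -sumr_const; apply: eq_bigr => j /eqP ->.
Qed.

                                                                            
                                                                      
                                                                         
                                                                      
                             
(** Bohr's argument. If no [x] in [K] works, the sum of the [e (chi i x - tau i)] stays uniformly
    below [n = #|I|] in modulus on [K]. Its [k]-th power is a combination of few distinct characters
    on [K], each with a small coefficient by [constant_term_le]; replacing every [chi i] by [tau i]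
    then gives a small number, although the relations force it to be near [n ^+ k]. The index [o] of
    the zero character supplies the reference term 1. *)
Lemma kronecker (eps : R) : 0 < eps ->
  exists N, forall tau : I -> T, tau o = 0 ->
    (forall p q : {ffun I -> 'I_N},
      (forall x, K x -> comb (chi^~ x) p = comb (chi^~ x) q) ->
      normc (e (comb tau p - comb tau q) - 1) <= 2^-1) ->
    exists2 x, K x & forall i, normc (e (chi i x - tau i) - 1) < eps.
Proof.
move=> eps0.
pose n : R := #|I|%:R.
have n1 : 1 <= n by rewrite /n ler1n; apply/card_gt0P; exists o.
(* By the parallelogram law, one term at distance at least [eps] from the reference term 1 lowers
   the sum from [n] to at most [n - eps ^+ 2 / 4], which is [n * (1 - eps ^+ 2 / (4 * n))]. *)
pose rho := Num.max 0 (1 - eps ^+ 2 / (4 * n)).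
have rho0 : 0 <= rho by rewrite le_max lexx.
have rho1 : rho < 1.
  by rewrite gt_max ltr01/= gtrBl divr_gt0 ?exprn_gt0// mulr_gt0// (lt_le_trans _ n1).
have half0 : 0 < 2^-1 :> R by rewrite invr_gt0.
have [k hk] := polynomial_mul_geometric_small #|I| rho0 rho1 half0.
(* Each index occurs at most [k] times in a word of length [k], so exponents below [k + 1]
   suffice. *)
exists k.+1 => tau tau0 Htau; apply: contrapT => far.
have {}far x : K x -> exists i, eps <= normc (e (chi i x - tau i) - 1).
  move=> Kx; apply: contrapT => /forallNP H; apply: far; exists x => // i.
  by rewrite ltNge; apply/negP/H.
pose z x i := e (chi i x - tau i).
have sumz x : K x -> normc (\sum_i z x i) <= n * rho.
  move=> Kx; have [i hi] := far x Kx.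
  have io : i != o.
    apply/eqP => io; move: hi.
    by rewrite io chi0 tau0 subrr e0 subrr normc0 leNgt eps0.
  rewrite (bigD1 o)//= (bigD1 i)//= addrA {1}/z chi0 tau0 subrr e0.
  apply: le_trans (normcD _ _) _.
  have h1 : normc (1 + z x i) <= 2 - eps ^+ 2 / 4.
    have hz := sqr_normc_parallelogram (e_norm (chi i x - tau i)).
    have hz2 : normc (z x i - 1) <= 2.
      by apply: le_trans (normcB _ _) _; rewrite e_norm normc1.
    have := normc_ge0 (1 + z x i); move: hz hi hz2; rewrite /z.
    set a := normc _; set b := normc _ => hz eb b2 a0.
    have Eb : eps ^+ 2 <= b ^+ 2 by rewrite lerXn2r ?nnegrE ?normc_ge0// ltW.
    have b4 : b ^+ 2 <= 4 by have := normc_ge0 (z x i - 1); rewrite -/b; nra.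
    rewrite -(@ler_pXn2r _ 2) ?nnegrE//; last by lra.
    by rewrite hz; move: Eb b4; set E := eps ^+ 2; have := sqr_ge0 E; nra.
  have h2 : normc (\sum_(j | (j != o) && (j != i)) z x j) <= n - 2.
    apply: le_trans (normc_sum _ _ _) _.
    under eq_bigr do rewrite e_norm.
    suff -> : n = 2 + \sum_(j | (j != o) && (j != i)) 1 by rewrite addrAC subrr add0r.
    rewrite /n -sum1_card (bigD1 o)//= (bigD1 i)//= addnA natrD natr_sum.
    by [].
  have h3 : n * (1 - eps ^+ 2 / (4 * n)) = n - eps ^+ 2 / 4 by field; lra.
  apply: (@le_trans _ _ (n * (1 - eps ^+ 2 / (4 * n)))); first by rewrite h3; lra.
  by rewrite ler_wpM2l ?(le_trans _ n1)// le_max lexx orbT.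
pose P := {ffun I -> 'I_k.+1}.
have cnt_lt (g : {ffun 'I_k -> I}) i : (#|[pred j | g j == i]| < k.+1)%N.
  by rewrite ltnS -[leqRHS]card_ord max_card.
pose cnt (g : {ffun 'I_k -> I}) : P := [ffun i => Ordinal (cnt_lt g i)].
have combE u (g : {ffun 'I_k -> I}) : \sum_j u (g j) = comb u (cnt g).
  by rewrite sum_count; apply: eq_bigr => i _; rewrite ffunE.
pose rel (p q : P) := `[< forall x, K x -> comb (chi^~ x) p = comb (chi^~ x) q >].
(* Exponent vectors that define the same character on [K] share one representative, so the expansion
   below runs over pairwise distinct characters on [K]. *)
pose rep p : P := odflt p [pick q | rel p q].
have rel_rep p : rel p (rep p).
  by rewrite /rep; case: pickP => [q //|/(_ p)] /= /asboolPn[] x.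
have rep_eq p q : rel p q -> rep p = rep q.
  move=> /asboolP pq; rewrite /rep.
  have -> : [pick r | rel p r] = [pick r | rel q r].
    apply: eq_pick => r; apply/asboolP/asboolP => h x Kx.
      by rewrite -pq// h.
    by rewrite pq// h.
  by case: pickP => [//|/(_ q)] /= /asboolPn[] x.
have rep_idem p : rep (rep p) = rep p by apply/esym/rep_eq.
pose Cf q := \sum_(g | rep (cnt g) == q) e (- comb tau (cnt g)).
have expand x : K x -> (\sum_i z x i) ^+ k =
    \sum_(q | rep q == q) Cf q * e (comb (chi^~ x) q).
  move=> Kx.
  rewrite -{1}(card_ord k) -prodr_const.
  rewrite bigA_distr_bigA/= (partition_big (rep \o cnt) (fun q => rep q == q))/=;
    last by move=> g _; apply/eqP.
  apply: eq_bigr => q _; rewrite mulr_suml; apply: eq_bigr => g /eqP hq.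
  have -> : \prod_(j < k) z x (g j) = e (\sum_j (chi (g j) x - tau (g j))).
    by rewrite (big_morph e eD e0).
  rewrite sumrB (combE (chi^~ x)) (combE tau) eD mulrC; congr (_ * e _).
  by rewrite -hq; exact: (asboolP _ (rel_rep (cnt g))).
have Cf_le q0 : rep q0 = q0 -> normc (Cf q0) <= (n * rho) ^+ k.
  move=> hq0.
  apply: (@constant_term_le R A K _ [seq q <- index_enum P | (rep q == q) && (q != q0)] Cf
    (fun q x => e (comb (chi^~ x) q - comb (chi^~ x) q0))) => //.
  - move=> q x y; rewrite -eD; congr e.
    rewrite -!sumrB -big_split/=; apply: eq_bigr => i _.
    by rewrite chiD !mulrnDl opprD addrACA.
  - move=> q; rewrite mem_filter => /andP[/andP[/eqP hq qq0] _].
    have : ~~ rel q q0 by apply: contra qq0 => /rep_eq; rewrite hq hq0 => /eqP.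
    move=> /asboolPn/existsNP[x /not_implyP[Kx hx]]; exists x => //.
    apply/eqP => /e_inj/eqP; rewrite subr_eq0 => /eqP; exact: hx.
  - move=> x Kx; rewrite big_filter.
    have -> : Cf q0 + \sum_(q | (rep q == q) && (q != q0))
        Cf q * e (comb (chi^~ x) q - comb (chi^~ x) q0) =
        (\sum_i z x i) ^+ k * e (- comb (chi^~ x) q0).
      rewrite expand// mulr_suml [RHS](bigD1 q0) ?hq0//= -mulrA eVK mulr1.
      by congr (_ + _); apply: eq_bigr => q _; rewrite eD mulrA.
    rewrite normcM e_norm mulr1 normcX lerXn2r ?nnegrE ?normc_ge0 ?sumz//.
    by rewrite mulr_ge0// (le_trans _ n1).
(* The expanded power with [chi] replaced by [tau]. Counting the exponent vectors makes [D] smaller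
   than [n ^+ k / 2]; the relations, each within 1/2, put it within [n ^+ k / 2] of [n ^+ k]. *)
pose D := \sum_(q | rep q == q) Cf q * e (comb tau q).
have hD1 : normc D <= (k.+1)%:R ^+ #|I| * (n * rho) ^+ k.
  apply: le_trans (normc_sum _ _ _) _.
  apply: (@le_trans _ _ (\sum_(q : P) (n * rho) ^+ k)).
    apply: (@le_trans _ _ (\sum_(q : P | rep q == q) (n * rho) ^+ k)).
      by apply: ler_sum => q /eqP hq; rewrite normcM e_norm mulr1 Cf_le.
    rewrite [leRHS](bigID (fun q => rep q == q))/= lerDl sumr_ge0// => q _.
    by rewrite exprn_ge0// mulr_ge0// (le_trans _ n1).
  by rewrite sumr_const card_ffun card_ord -[leLHS]mulr_natl natrX.
have hD2 : normc (D - (#|I| ^ k)%:R) <= n ^+ k / 2.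
  have -> : D = \sum_(g : {ffun 'I_k -> I}) e (comb tau (rep (cnt g)) - comb tau (cnt g)).
    rewrite (partition_big (rep \o cnt) (fun q => rep q == q))/=;
      last by move=> g _; apply/eqP.
    apply: eq_bigr => q _; rewrite mulr_suml; apply: eq_bigr => g /eqP <-.
    by rewrite eD mulrC.
  have -> : (#|I| ^ k)%:R = \sum_(g : {ffun 'I_k -> I}) (1 : R[i]).
    by rewrite sumr_const card_ffun card_ord.
  rewrite -sumrB; apply: le_trans (normc_sum _ _ _) _.
  apply: (@le_trans _ _ (\sum_(g : {ffun 'I_k -> I}) 2^-1)).
    apply: ler_sum => g _; apply: Htau => x Kx.
    by apply/esym; exact: (asboolP _ (rel_rep (cnt g))).
  by rewrite sumr_const card_ffun card_ord -[leLHS]mulr_natl natrX.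
have hnk : normc ((#|I| ^ k)%:R : R[i]) = n ^+ k.
  by rewrite -(rmorph_nat (real_complex R)) normc_real normr_nat natrX.
have : n ^+ k <= normc D + normc (D - (#|I| ^ k)%:R).
  by rewrite -hnk -{1}(subKr D (#|I| ^ k)%:R) normcB.
have nk0 : 0 < n ^+ k by rewrite exprn_gt0// (lt_le_trans _ n1).
have : (k.+1)%:R ^+ #|I| * (n * rho) ^+ k < n ^+ k / 2.
  by rewrite exprMn mulrCA ltr_pM2l.
move: hD1 hD2; set a := normc _; set b := normc _; lra.
Qed.
End Kronecker.

Local Notation R := Rdefinitions.R.
Local Notation T := Tcirc.

                                 

(** * The quotient map: continuity, openness, translations *)

Section QuotientMap.
Variables (A : topologicalZmodType) (K : subgroup A).

Definition proj (x : A) : quot K := (\pi_(quot_car K) x)%qT.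

Lemma projP x y : proj x = proj y <-> sg_set K (x - y).
Proof. exact: Defs.piP. Qed.

Lemma proj_surj q : exists x, q = proj x.
Proof. by exists (repr (q : quot_car K)); rewrite /proj reprK. Qed.

Lemma projD x y : proj (x + y) = proj x + proj y.
Proof.
apply/esym/Defs.piP; set r := repr _; set s := repr _.
have -> : r + s - (x + y) = (r - x) - (y - s).
  by rewrite !opprD opprK addrACA [- y + s]addrC.
apply: sg_sub; first exact: repr_pi.
by have := sg_sub (sg_0 K) (repr_pi K y); rewrite sub0r opprB.
Qed.

Lemma proj0 : proj 0 = 0. Proof. by []. Qed.

Lemma sg_add x y : sg_set K x -> sg_set K y -> sg_set K (x + y).
Proof.
move=> Kx Ky; rewrite -[y]opprK; apply: sg_sub => //.
by rewrite -sub0r; apply: sg_sub => //; exact: sg_0.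
Qed.

Lemma proj_eq0 x : proj x = 0 <-> sg_set K x.
Proof. by rewrite -proj0 projP subr0. Qed.

Lemma proj_continuous : continuous proj.
Proof. exact: (@pi_continuous A (quot_car K)). Qed.

Lemma translation_continuous (x : A) : continuous (fun y : A => y + x).
Proof.
move=> y; apply: (@continuous_comp _ _ _ (fun y => (y, x)) (fun z : A * A => z.1 + z.2)).
  by apply: cvg_pair => /=; [exact: cvg_id|exact: cvg_cst].
exact: add_continuous.
Qed.

Lemma open_proj_preimage (U : set (quot K)) : open (proj @^-1` U) -> open U.
Proof. by []. Qed.

(** The saturation of [U] is the union of its translates by elements of [K]. *)
Lemma proj_open (U : set A) : open U -> open (proj @` U).
Proof.
move=> oU; apply: open_proj_preimage.
have -> : proj @^-1` (proj @` U) =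
    \bigcup_(k in sg_set K) ((fun y => y + k) @^-1` U).
  apply/seteqP; split=> x /=.
    move=> [u Uu /projP ux]; exists (u - x) => //=.
    by rewrite addrC subrK.
  move=> [k Kk /= Uxk]; exists (x + k) => //; apply/projP.
  by rewrite addrAC subrr add0r.
apply: bigcup_open => k _; apply: open_comp => // y _.
exact: translation_continuous.
Qed.

Lemma nbhs_proj (a : A) (N : set A) : nbhs a N -> nbhs (proj a) (proj @` N).
Proof.
rewrite nbhsE => -[U [oU Ua] UN]; rewrite nbhsE; exists (proj @` U).
  by split; [exact: proj_open|exists a].
exact: image_subset.
Qed.

Lemma quot_translation_continuous (q : quot K) :
  continuous (fun p : quot K => p + q).
Proof.
have [x ->] := proj_surj q.
apply/continuousP => U oU; apply: open_proj_preimage.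
have -> : proj @^-1` ((fun p => p + proj x) @^-1` U) =
    (fun y => y + x) @^-1` (proj @^-1` U).
  by apply/seteqP; split=> y /=; rewrite projD.
apply: open_comp; first by move=> y _; exact: translation_continuous.
by apply: open_comp => // y _; exact: proj_continuous.
Qed.
End QuotientMap.

(** * The circle and its chord length *)

Lemma chord_continuous (F : realType) :
  continuous (fun x : F => Num.sqrt (2 - 2 * cos (2 * pi * x))).
Proof.
move=> x; apply: (@continuous_comp F F F (fun x => 2 - 2 * cos (2 * pi * x)) Num.sqrt);
  last exact: sqrt_continuous.
apply: continuousB; first exact: cst_continuous.
apply: continuousM; first exact: cst_continuous.
apply: (@continuous_comp F F F (fun x => 2 * pi * x) (@cos F)); last exact: continuous_cos.
by apply: continuousM; [exact: cst_continuous|exact: cvg_id].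
Qed.

Section Circle.

Definition tproj : R -> T := @proj R^o intsub.

Lemma tproj_surj t : exists x, t = tproj x.
Proof. exact (@proj_surj R^o intsub t). Qed.

Lemma tprojD x y : tproj (x + y) = tproj x + tproj y.
Proof. exact (@projD R^o intsub x y). Qed.

Lemma tprojP x y : tproj x = tproj y <-> x - y \is a Num.int.
Proof. exact (@projP R^o intsub x y). Qed.

Definition cis (x : R) : R[i] := cos (2 * pi * x) +i* sin (2 * pi * x).

Lemma cisD x y : cis (x + y) = cis x * cis y.
Proof.
rewrite /cis mulrDr cosD sinD; simpc; congr (_ +i* _).
by rewrite addrC.
Qed.

Lemma cis_int x : x \is a Num.int -> cis x = 1.
Proof.
have cisn n : cis n%:R = 1.
  rewrite /cis mulr_natr [2 * pi]mulr_natl; congr (_ +i* _).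
    by rewrite -[LHS](congr1 cos (add0r _)) (periodicn (@cosD2pi R)) cos0.
  by rewrite -[LHS](congr1 sin (add0r _)) (periodicn (@sinD2pi R)) sin0.
move=> /intrP[[n ->|n ->]]; first exact: cisn.
rewrite NegzE; have := cisD (n.+1%:R) (- n.+1%:R).
by rewrite subrr -[0]/(0%:R) !cisn mul1r mulrNz => <-.
Qed.

Lemma normc_cis x : normc (cis x) = 1.
Proof. by rewrite /= cos2Dsin2 sqrtr1. Qed.

(** The exponential [exp (2 i pi t)], computed on the chosen representative of the class; [eeE]
    frees it from that choice. *)
Definition ee (t : T) : R[i] := cis (repr (t : quot_car intsub)).

Lemma eeE x : ee (tproj x) = cis x.
Proof.
have h : (repr (tproj x : quot_car intsub) : R) - x \is a Num.int.
  exact: (@repr_pi R^o intsub x).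
by rewrite /ee -[X in cis X](subrK x) cisD (cis_int h) mul1r.
Qed.

Lemma eeD s t : ee (s + t) = ee s * ee t.
Proof.
have [x ->] := tproj_surj s; have [y ->] := tproj_surj t.
by rewrite -tprojD !eeE cisD.
Qed.

Lemma normc_ee t : normc (ee t) = 1.
Proof. by have [x ->] := tproj_surj t; rewrite eeE normc_cis. Qed.

Lemma ee0 : ee 0 = 1.
Proof. by rewrite -[0]/(tproj 0) eeE cis_int. Qed.

(** The chord from 1 to [ee t]: a translation-invariant norm that replaces the quotient topology of
    the circle in all estimates. *)
Definition nu (t : T) : R := normc (ee t - 1).

Lemma nu_tproj x : nu (tproj x) = Num.sqrt (2 - 2 * cos (2 * pi * x)).
Proof.
rewrite /nu eeE /= oppr0 addr0; congr Num.sqrt.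
by have := cos2Dsin2 (2 * pi * x); nra.
Qed.

Lemma nu_ge0 t : 0 <= nu t. Proof. exact: normc_ge0. Qed.

Lemma nu0 : nu 0 = 0.
Proof. by rewrite /nu ee0 subrr normc0. Qed.

Lemma nuD s t : nu (s + t) <= nu s + nu t.
Proof.
rewrite /nu eeD.
have -> : ee s * ee t - 1 = ee s * (ee t - 1) + (ee s - 1) by ring.
by apply: le_trans (normcD _ _) _; rewrite normcM normc_ee mul1r addrC.
Qed.

Lemma nuN t : nu (- t) = nu t.
Proof.
rewrite /nu -[RHS]mul1r -(normc_ee (- t)) -normcM mulrBr -eeD addNr ee0 mulr1.
by rewrite -normcN opprB.
Qed.

Lemma nuB s t : nu (s - t) <= nu s + nu t.
Proof. by rewrite -(nuN t) nuD. Qed.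

Lemma nuC s t : nu (s - t) = nu (t - s).
Proof. by rewrite -nuN opprB. Qed.

Lemma nu_triangle s t u : nu (s - u) <= nu (s - t) + nu (t - u).
Proof. by rewrite -[s - u](subrKA t) nuD. Qed.

Lemma nu_continuous : continuous nu.
Proof.
apply/(@quotient_continuous R^o (quot_car intsub)).
rewrite (_ : _ \o _ = fun x : R => Num.sqrt (2 - 2 * cos (2 * pi * x))).
  exact: chord_continuous.
by apply/funext => x /=; exact: nu_tproj.
Qed.

Lemma nu_sub_continuous (t : T) : continuous (fun s : T => nu (s - t)).
Proof.
move=> s; apply: (@continuous_comp _ _ _ (fun s => s - t) nu); last exact: nu_continuous.
exact: (@quot_translation_continuous R^o intsub).
Qed.

Lemma nbhs_nu_lt (t : T) (e : R) : 0 < e -> \forall s \near t, nu (s - t) < e.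
Proof.
move=> e0; apply: (@nu_sub_continuous t t [set r | r < e]).
by rewrite /= subrr nu0; exact: lt_nbhsl.
Qed.

Lemma tproj_centered t : exists2 x, t = tproj x & `|x| <= 2^-1.
Proof.
have [x0 ->] := tproj_surj t.
exists (x0 - (Num.floor (x0 + 2^-1))%:~R).
  by apply/tprojP; rewrite subKr intr_int.
have /andP[h1 h2] := floor_itv (x0 + 2^-1).
by move: h2; rewrite intrD ler_norml => h2; lra.
Qed.

Lemma cos_2pi_norm (x : R) : cos (2 * pi * `|x|) = cos (2 * pi * x).
Proof. by rewrite -[RHS]cos_norm !normrM (ger0_norm (pi_ge0 _)) ger0_norm. Qed.

Lemma mul2pi_norm_itv (x : R) : `|x| <= 2^-1 -> 2 * pi * `|x| \in `[0, (pi : R)].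
Proof.
move=> h; have p0 : 0 < pi :> R := pi_gt0 _.
rewrite in_itv/=; apply/andP; split; first by rewrite !mulr_ge0// ltW.
by nra.
Qed.

                                                                  
                                                          
(** Every class has a representative in [[-1/2, 1/2]], where the cosine is strictly decreasing in
    [|x|]; a chord shorter than that of [c] therefore forces [|x| < c]. *)
Lemma nu_lt_nbhs0 (U : set T) : nbhs 0 U -> exists2 e : R, 0 < e & forall t, nu t < e -> U t.
Proof.
move=> U0; have /nbhs_ballP[d /= d0 hd] : nbhs (0 : R) (tproj @^-1` U).
  exact: (@proj_continuous R^o intsub 0 U U0).
pose c := Num.min d 2^-1.
have c0 : 0 < c by rewrite lt_min d0/= invr_gt0.
have c2 : c <= 2^-1 by rewrite ge_min lexx orbT.
have p0 : 0 < pi :> R := pi_gt0 _.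
have hc : 2 * pi * c \in `[0, (pi : R)].
  by have := @mul2pi_norm_itv c; rewrite ger0_norm ?(ltW c0)//; exact.
have cc : cos (2 * pi * c) < 1.
  rewrite -[ltRHS]cos0 ltr_cos//; last by rewrite in_itv/= lexx ltW.
  by rewrite !mulr_gt0.
exists (Num.sqrt (2 - 2 * cos (2 * pi * c))).
  by rewrite sqrtr_gt0; lra.
move=> t; have [x -> x2] := tproj_centered t.
rewrite nu_tproj ltr_sqrt; last by lra.
rewrite ltrD2l ltrN2 ltr_pM2l// => hx.
have xc : `|x| < c.
  move: hx; rewrite -(cos_2pi_norm x) ltr_cos//; first by rewrite ltr_pM2l// mulr_gt0.
  exact: mul2pi_norm_itv.
apply: hd; rewrite /ball/= sub0r normrN.
by apply: lt_le_trans xc _; rewrite ge_min lexx.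
Qed.

Lemma nu_lt_nbhs (t : T) (U : set T) : nbhs t U ->
  exists2 e : R, 0 < e & forall s, nu (s - t) < e -> U s.
Proof.
move=> Ut; have [e e0 he] : exists2 e : R, 0 < e & forall s, nu s < e -> U (s + t).
  apply: nu_lt_nbhs0; apply: (@quot_translation_continuous R^o intsub t 0 U).
  by rewrite add0r.
by exists e => // s /he; rewrite subrK.
Qed.

Lemma nu_eq0 t : nu t = 0 -> t = 0.
Proof.
have [x -> x2] := tproj_centered t.
rewrite nu_tproj => /eqP; rewrite sqrtr_eq0 => h.
have p0 : 0 < pi :> R := pi_gt0 _.
have h1 : cos (2 * pi * `|x|) = cos 0.
  by rewrite cos_2pi_norm cos0; have := cos_le1 (2 * pi * x); lra.
have z0 : 0 \in `[0, (pi : R)] by rewrite in_itv/= lexx ltW.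
have /eqP := cos_inj (mul2pi_norm_itv x2) z0 h1.
rewrite !mulf_eq0 pnatr_eq0/= gt_eqF//= normr_eq0 => /eqP ->.
by [].
Qed.

Lemma nu_small_eq0 t : (forall e : R, 0 < e -> nu t < e) -> t = 0.
Proof.
move=> h; apply: nu_eq0; apply/eqP; rewrite eq_le nu_ge0 andbT.
by apply/ler_addgt0Pr => e e0; rewrite add0r ltW// h.
Qed.

Lemma ee_inj t : ee t = 1 -> t = 0.
Proof. by move=> h; apply: nu_eq0; rewrite /nu h subrr normc0. Qed.

                                                                                 
(** While chords stay at most 1/2, doubling multiplies them by at least 3/2, because
    [ee s ^+ 2 - 1 = (ee s + 1) * (ee s - 1)] and the first factor has modulus at least
    [2 - 1/2]. *)
Lemma no_small_subgroup t : (forall n, nu (t *+ n) <= 2^-1) -> t = 0.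
Proof.
move=> h; have step s : nu s <= 2^-1 -> 3 / 2 * nu s <= nu (s *+ 2).
  move=> hs; rewrite /nu [s *+ 2]mulr2n eeD.
  have -> : ee s * ee s - 1 = (ee s + 1) * (ee s - 1) by ring.
  rewrite normcM; apply: ler_wpM2r; first exact: normc_ge0.
  have : normc (2%:R : R[i]) <= normc (ee s + 1) + nu s.
    have -> : 2%:R = (ee s + 1) - (ee s - 1) :> R[i] by ring.
    exact: normcB.
  rewrite -(rmorph_nat (real_complex R)) normc_real normr_nat; lra.
have pw n : (3 / 2) ^+ n * nu t <= 2^-1.
  apply: le_trans (h (2 ^ n)%N).
  elim: n => [|n IH]; first by rewrite expr0 mul1r.
  rewrite expnSr mulrnA exprS -mulrA.
  apply: le_trans (step _ (h _)); apply: ler_wpM2l => //; lra.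
apply: nu_small_eq0 => e e0; rewrite ltNge; apply/negP => hte.
(* A linear lower bound is enough: for [N > 2 / e] it makes the grown chord exceed 1, against the
   bound 1/2. *)
have b n : n%:R / 2 <= (3 / 2 : R) ^+ n.
  elim: n => [|n IH]; first by rewrite mul0r expr0.
  have : 1 <= (3 / 2 : R) ^+ n by apply: exprn_ege1; lra.
  by rewrite exprS -(natr1 n); lra.
pose N := (Num.truncn (2 / e)).+1.
have : 2 / e < N%:R := truncnS_gt _.
rewrite ltr_pdivrMr// => hN.
have : N%:R / 2 * e <= (3 / 2) ^+ N * nu t.
  by apply: ler_pM (b N) hte; [rewrite divr_ge0|exact: ltW].
by move: hN (pw N); move: (_ * nu t) (N%:R) => x y; lra.
Qed.

Lemma Tcirc_divisible (t : T) n : exists s, s *+ n.+1 = t.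
Proof.
have [x ->] := tproj_surj t; exists (tproj (x / n.+1%:R)).
have E m y : tproj (y *+ m) = tproj y *+ m.
  by elim: m => [//|m IH]; rewrite !mulrS tprojD IH.
by rewrite -E -[X in tproj X]mulr_natr divfK// pnatr_eq0.
Qed.
End Circle.

                                             

(** * The compact-open topology as uniform convergence on compact sets *)

Section CompactOpen.
Variable Y : topologicalType.

Lemma compact_open_nuP (f : {compact-open, Y -> T}) (F : set_system {compact-open, Y -> T}) :
  continuous (f : Y -> T) -> Filter F ->
  F --> f <-> forall (C : set Y) (e : R), compact C -> 0 < e ->
    F [set g | forall y, C y -> nu (g y - f y) < e].
Proof.
move=> cf FF; split=> [Ff C e cC e0|H].
  move/compact_open_cvgP: Ff => Ff.
  have /compact_near_coveringP/near_covering_withinP := cC.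
  apply => y Cy.
  (* On the compact piece [Cx] the map [f] varies by at most [e / 3] from [f y], and [g] is forced
     within [e / 2] of [f y]; the total stays below [e]. *)
  pose Cx := C `&` [set x | nu (f x - f y) <= e / 3].
  pose O := [set t | nu (t - f y) < e / 2].
  have cCx : compact Cx.
    apply: compact_closedI => //.
    apply: (@closed_comp _ _ (fun x => nu (f x - f y)) [set r | r <= e / 3]).
      move=> x _; apply: (@continuous_comp _ _ _ f (fun s => nu (s - f y))).
        exact: cf.
      exact: nu_sub_continuous.
    exact: closed_le.
  have oO : open O.
    apply: (@open_comp _ _ (fun s => nu (s - f y)) [set r | r < e / 2]).
      by move=> s _; exact: nu_sub_continuous.
    exact: open_lt.
  have fO : f @` Cx `<=` O by move=> _ [x [_ /= h] <-]; rewrite /O/=; lra.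
  exists ([set x | nu (f x - f y) <= e / 3], [set g | g @` Cx `<=` O]).
    split => /=; last exact: Ff.
    have e3 : 0 < e / 3 by lra.
    apply: (@filterS _ (nbhs y) _ [set x | nu (f x - f y) < e / 3]).
      by move=> x /= /ltW.
    exact: cf y _ (nbhs_nu_lt (f y) e3).
  move=> [x g] /= [h1 h2] Cx0.
  have : O (g x) by apply: h2; exists x => //; split.
  rewrite /O/= => h3; apply: le_lt_trans (nu_triangle _ (f y) _) _.
  by rewrite [nu (f y - _)]nuC; lra.
apply/compact_open_cvgP => C O cC oO fO.
have /compact_near_coveringP cov := cC.
have [d /= d0 hd] : \forall e \near (0 : R)^'+,
    C `<=` (fun y => forall t, nu (t - f y) < e -> O t).
  apply: (cov _ _ (fun e y => forall t, nu (t - f y) < e -> O t)) => y Cy.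
  have [e e0 he] : exists2 e : R, 0 < e & forall s, nu (s - f y) < e -> O s.
    by apply: nu_lt_nbhs; apply: open_nbhs_nbhs; split => //; apply: fO; exists y.
  have e2 : 0 < e / 2 by lra.
  exists ([set x | nu (f x - f y) < e / 2], [set d | d < e / 2]).
    split => /=; last exact: nbhs_right_lt.
    exact: cf y _ (nbhs_nu_lt (f y) e2).
  move=> [x d] /= [h1 h2] t h3; apply: he.
  by apply: le_lt_trans (nu_triangle _ (f x) _) _; lra.
have d20 : 0 < d / 2 by lra.
have := H C (d / 2) cC d20; apply: filterS => g /= hg _ [y Cy <-].
apply: (hd (d / 2)) (hg _ Cy) => //.
by rewrite /ball /= sub0r normrN ger0_norm; lra.
Qed.
Lemma Tcirc_continuousP (f : Y -> T) y :
  {for y, continuous f} <-> forall e : R, 0 < e -> \forall z \near y, nu (f z - f y) < e.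
Proof.
split=> [cf e e0|h U /nu_lt_nbhs[e e0 he]].
  exact: cf _ (nbhs_nu_lt (f y) e0).
by have := h e e0; apply: filterS => z /he.
Qed.

End CompactOpen.

(** * Characters, the dual, and a criterion for [alpha] to be a topological isomorphism *)

Section Dual.
Variable X : PreTopologicalZmodule.type.
Implicit Types (c d : dual X) (x y : X).

Definition ev c : X -> T := set_val c.

Lemma ev_char c : is_char X (ev c). Proof. exact: set_valP. Qed.

Lemma evD c x y : ev c (x + y) = ev c x + ev c y.
Proof. exact: (ev_char c).1. Qed.

Lemma ev_continuous c : continuous (ev c).
Proof. exact: (ev_char c).2. Qed.

Lemma ev0 c : ev c 0 = 0.
Proof. by apply: (addIr (ev c 0)); rewrite -evD !add0r. Qed.

Lemma evN c x : ev c (- x) = - ev c x.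
Proof. by apply/eqP; rewrite -subr_eq0 opprK -evD addNr ev0. Qed.

Lemma evB c x y : ev c (x - y) = ev c x - ev c y.
Proof. by rewrite evD evN. Qed.

Lemma ev_inj c d : (forall x, ev c x = ev d x) -> c = d.
Proof. by move=> h; apply: val_inj; apply/funext => x; exact: h. Qed.

Definition mkchar (f : X -> T) (hf : is_char X f) : dual X := exist _ f (mem_set hf).

Lemma mkcharE f (hf : is_char X f) x : ev (mkchar hf) x = f x.
Proof. by []. Qed.

Lemma is_char0 : is_char X (fun=> 0).
Proof. by split=> [x y|]; [rewrite addr0|exact: cst_continuous]. Qed.

Lemma is_charB (f g : X -> T) : is_char X f -> is_char X g -> is_char X (f \- g).
Proof.
move=> [fD fc] [gD gc]; split=> [x y|x]; first by rewrite /= fD gD opprD addrACA.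
apply/Tcirc_continuousP => e e0; have e2 : 0 < e / 2 by lra.
move: (fc x) (gc x) => /Tcirc_continuousP/(_ _ e2) hf /Tcirc_continuousP/(_ _ e2) hg.
near=> z; have -> : (f \- g) z - (f \- g) x = (f z - f x) - (g z - g x).
  by rewrite /= !opprB addrACA [RHS]addrACA; congr (_ + _); rewrite addrC.
apply: le_lt_trans (nuB _ _) _.
have : nu (f z - f x) < e / 2 by near: z.
have : nu (g z - g x) < e / 2 by near: z.
lra.
Unshelve. all: by end_near. Qed.

Lemma is_charD (f g : X -> T) : is_char X f -> is_char X g -> is_char X (f \+ g).
Proof.
move=> hf hg; have := is_charB hf (is_charB is_char0 hg).
by congr (is_char X _); apply/funext => x /=; rewrite sub0r opprK.
Qed.

(** Pointwise operations given by hand, as the type [dual X] is not declared to be a group. *)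
Definition dsub c d : dual X := mkchar (is_charB (ev_char c) (ev_char d)).
Definition dadd c d : dual X := mkchar (is_charD (ev_char c) (ev_char d)).
Definition dzero : dual X := mkchar is_char0.

Lemma dsubE c d x : ev (dsub c d) x = ev c x - ev d x. Proof. by []. Qed.

Lemma dual_cvgE c (F : set_system (dual X)) : Filter F ->
  F --> c <-> set_val @ F --> (set_val c : {compact-open, X -> T}).
Proof.
move=> FF; split=> [Fc U Uc|h A].
  by apply: Fc; exact: (@initial_continuous _ _ (set_val : dual X -> _) c U Uc).
rewrite nbhsE => -[B [[V oV <-] Vc] /filterS]; apply.
by apply: (h V); apply: open_nbhs_nbhs; split.
Qed.

Lemma dual_cvgP c (F : set_system (dual X)) : Filter F ->
  F --> c <-> forall (C : set X) (e : R), compact C -> 0 < e ->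
    F [set d | forall x, C x -> nu (ev d x - ev c x) < e].
Proof.
move=> FF; rewrite dual_cvgE//.
exact: (@compact_open_nuP X (set_val c) (set_val @ F) (@ev_continuous c)).
Qed.

Lemma dsub_continuous d : continuous (fun c => dsub c d).
Proof.
move=> c; apply/(@dual_cvgP (dsub c d) _ (fmap_filter _ (nbhs_filter c))) => C e cC e0.
have /dual_cvgP/(_ C e cC e0) : nbhs c --> c by [].
apply: filterS => c' h x Cx /=.
by rewrite !dsubE opprB addrA subrK h.
Qed.

Lemma eval_continuous x : continuous (fun c => ev c x).
Proof.
move=> c; apply/Tcirc_continuousP => e e0.
have /dual_cvgP/(_ [set x] e (@compact_set1 _ _) e0) : nbhs c --> c by [].
by apply: filterS => d; apply.
Qed.

Lemma alpha_bidual x : bidual X (alpha X x).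
Proof.
split; last exact: eval_continuous.
by move=> c1 c2 c3 h; exact: h.
Qed.

Definition equicontinuous_duals := forall (C : set (dual X)) (e : R), compact C -> 0 < e ->
  \forall x \near (0 : X), forall c, C c -> nu (ev c x) < e.

Definition polars_nbhs_base := forall U, nbhs (0 : X) U ->
  exists (C : set (dual X)) (e : R), [/\ compact C, 0 < e &
    forall x, (forall c, C c -> nu (ev c x) < e) -> U x].

Hypothesis translC : forall x, continuous (fun y => y + x).

Let nbhs_transl x U : nbhs x U -> nbhs 0 [set y | U (y + x)].
Proof. by move=> Ux; apply: (translC (x := x) (x0 := 0)); rewrite add0r. Qed.

Let nbhs_transl0 x U : nbhs (0 : X) U -> nbhs x [set y | U (y - x)].
Proof. by move=> Ux; apply: (translC (x := - x) (x0 := x)); rewrite subrr. Qed.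

(** Uniform convergence on compact sets of characters, read at 0, is exactly equicontinuity;
    translations carry it to every point. Their continuity is a hypothesis of the section so that
    the lemma serves both [A] and [quot K]. *)
Lemma alpha_continuousP : continuous (alpha X) <-> equicontinuous_duals.
Proof.
split=> [ca C e cC e0|h x].
  have /compact_open_nuP := ca 0.
  move=> /(_ (@eval_continuous 0) C e cC e0) h.
  have {h} : nbhs (0 : X) [set x | forall c, C c -> nu (alpha X x c - alpha X 0 c) < e].
    exact: h.
  apply: filterS => x /= hx c Cc; have := hx c Cc.
  by rewrite [alpha X 0 c]ev0 subr0.
apply/compact_open_nuP; first exact: eval_continuous.
move=> C e cC e0; have := @nbhs_transl0 x _ (h C e cC e0).
by apply: filterS => y /= hy c Cc; have := hy c Cc; rewrite evB.
Qed.

(** Polars of compact sets are the traces on [X] of the basic neighbourhoods of [alpha X 0];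
    translation reduces openness to this point. *)
Lemma alpha_openP : injective (alpha X) -> range (alpha X) = bidual X ->
  (forall U : set X, open U -> exists V : set {compact-open, dual X -> T},
          open V /\ (@alpha X) @` U = V `&` bidual X) <-> polars_nbhs_base.
Proof.
move=> inj rg; split=> [h U|h U oU].
  rewrite nbhsE => -[U' [oU' U'0] U'U]; have [V [oV VE]] := h _ oU'.
  (* The filter generated by the polar conditions converges to [alpha X 0], so the open set [V]
     contains one of its basic sets. *)
  pose G : set_system {compact-open, dual X -> T} :=
    filter_from [set Ce : set (dual X) * R | compact Ce.1 /\ 0 < Ce.2]
      (fun Ce => [set g | forall c, Ce.1 c -> nu (g c) < Ce.2]).
  have FG : Filter G.
    apply: filter_from_filter.
      by exists (set0, 1); split => //; exact: compact0.
    move=> [C1 e1] [C2 e2] [/= c1 e10] [/= c2 e20].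
    exists (C1 `|` C2, Num.min e1 e2); first by split; [exact: compactU|rewrite lt_min e10].
    move=> g /= hg; split=> c Cc; have := hg c.
      by rewrite lt_min => /(_ (or_introl Cc))/andP[].
    by rewrite lt_min => /(_ (or_intror Cc))/andP[].
  have G0 : G --> alpha X 0.
    apply/compact_open_nuP; first exact: eval_continuous.
    move=> C e cC e0; exists (C, e) => // g /= hg c Cc.
    by rewrite [alpha X 0 c]ev0 subr0 hg.
  have : V (alpha X 0).
    have : (V `&` bidual X) (alpha X 0) by rewrite -VE; exists 0.
    by case.
  move=> V0; have [[C e] [/= cC e0] CV] : G V.
    by apply: G0; apply: open_nbhs_nbhs; split.
  exists C, e; split => // x hx.
  have : (V `&` bidual X) (alpha X x).
    by split; [apply: CV => c Cc; exact: hx|exact: alpha_bidual].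
  by rewrite -VE => -[u U'u /inj <-]; exact: U'U.
(* The open set wanted is the union of all open sets whose trace on the image of [alpha] comes from
   [U]. *)
pose good (V : set {compact-open, dual X -> T}) := open V /\ forall x, V (alpha X x) -> U x.
exists (\bigcup_(V in good) V); split; first by apply: bigcup_open => V [].
apply/seteqP; split=> [_ [x Ux <-]|g [[V [oV hV] Vg]]]; last first.
  by rewrite -rg => -[x _ gx]; exists x => //; apply: hV; rewrite gx.
split; last exact: alpha_bidual.
have [C [e [cC e0 he]]] := h _ (nbhs_transl (open_nbhs_nbhs (conj oU Ux))).
pose V := [set g : {compact-open, dual X -> T} |
  forall c, C c -> nu (g c - ev c x) < e].
have /compact_open_nuP : nbhs (alpha X x) --> alpha X x by [].
move=> /(_ (@eval_continuous x) C e cC e0); rewrite nbhsE => -[W [oW Wx] WV].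
exists W => //; split => // y /WV hy.
rewrite -(subrK x y); apply: he => c Cc; rewrite evB; exact: hy.
Qed.

Lemma alpha_topisoP : alpha_topiso X <->
  [/\ injective (alpha X), alpha_surjective X, equicontinuous_duals & polars_nbhs_base].
Proof.
split=> [[inj rg c o]|[inj sj eq po]].
  split => //; [by rewrite /alpha_surjective rg|exact/alpha_continuousP|exact/alpha_openP].
have rg : range (alpha X) = bidual X.
  by apply/seteqP; split => // _ [x _ <-]; exact: alpha_bidual.
by split => //; [exact/alpha_continuousP|exact/alpha_openP].
Qed.

End Dual.

                                       

(** * Extension of homomorphisms into a divisible group *)

Section DivisibleExtension.
Variables (G D : zmodType) (divD : forall (t : D) n, exists s, s *+ n.+1 = t).

(** Zorn's lemma applied to graphs of partial homomorphisms; single-valuedness of a subgroup of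
    [G * D] is the condition that [(0, t)] belongs to it only for [t = 0]. *)
Lemma divisible_extension (B : set G) (psi : G -> D) :
  B 0 -> (forall x y, B x -> B y -> B (x - y)) ->
  (forall x y, B x -> B y -> psi (x - y) = psi x - psi y) ->
  exists Psi : G -> D, (forall x y, Psi (x + y) = Psi x + Psi y) /\
    forall x, B x -> Psi x = psi x.
Proof.
move=> B0 BB psiB.
pose G0 : set (G * D) := [set p | B p.1 /\ p.2 = psi p.1].
                                                                            
                                                          
(* Containing [G0] is asked of nonempty [H] only, so that the union of the empty chain also
   satisfies [P]. *)
pose P (H : set (G * D)) := [/\ forall p, H p -> G0 `<=` H,
  forall g s h t, H (g, s) -> H (h, t) -> H (g - h, s - t)
  & forall t, H (0, t) -> t = 0].
have psi0 : psi 0 = 0 by have := psiB 0 0 B0 B0; rewrite !subrr.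
have PG0 : P G0.
  split=> [p _ q //||t [_ /= ->]//].
  by move=> g s h t [/= Bg ->] [/= Bh ->]; split => /=; [exact: BB|rewrite psiB].
have [F FP tot|H [[HG HB H0] Hmax]] := @Zorn_bigcup _ P.
  split.
  - by move=> p [X FX Xp] q G0q; exists X => //; have [h _ _] := FP _ FX;
      exact: (h _ Xp _ G0q).
  - move=> g s h t [X FX Xg] [Y FY Yh].
    have [XY|YX] := tot _ _ FX FY.
      by exists Y => //; have [_ + _] := FP _ FY; apply => //; exact: XY.
    by exists X => //; have [_ + _] := FP _ FX; apply => //; exact: YX.
  - by move=> t [X FX Xt]; have [_ _] := FP _ FX; apply.
have [p Hp] : exists p, H p.
  apply: contrapT => nH; apply: (Hmax G0) => //; split; last first.
    by move=> /(_ (0, 0)); apply: contra_not nH => h; exists (0, 0); apply: h; split.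
  by move=> q Hq; case: nH; exists q.
have {}HG := HG _ Hp.
have HH0 : H (0, 0) by apply: HG; split.
have HN g s : H (g, s) -> H (- g, - s).
  by move=> h; have := HB _ _ _ _ HH0 h; rewrite !sub0r.
have HD g s h t : H (g, s) -> H (h, t) -> H (g + h, s + t).
  by move=> h1 h2; have := HB _ _ _ _ h1 (HN _ _ h2); rewrite !opprK.
have HMn g s n : H (g, s) -> H (g *+ n, s *+ n).
  move=> h; elim: n => [|n IH]; first by rewrite !mulr0n.
  by rewrite !mulrS; exact: HD.
have HMz g s z : H (g, s) -> H (g *~ z, s *~ z).
  move=> h; case: z => n; first by rewrite -!pmulrn; exact: HMn.
  by rewrite !NegzE !mulrNz -!pmulrn; apply: HN; exact: HMn.
have Hfun g s t : H (g, s) -> H (g, t) -> s = t.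
  move=> h1 h2; have := HB _ _ _ _ h1 h2; rewrite subrr => /H0/eqP.
  by rewrite subr_eq0 => /eqP.
have Htot x : exists t, H (x, t).
  apply: contrapT => nx.
  (* The value to give at [x]: if some positive multiple of [x] lies in the domain, divide the value
     at the least one; otherwise take 0. Euclidean division shows that it fits every multiple. *)
  have [t ht] : exists t, forall z s, H (x *~ z, s) -> s = t *~ z.
    have [[m m0 [u Hu]]|none] := pselect (exists2 m, (0 < m)%N & exists u, H (x *+ m, u)).
      have ex : exists m, (0 < m)%N && `[< exists u, H (x *+ m, u) >].
        by exists m; rewrite m0; apply/asboolP; exists u.
      case: (ex_minnP ex) => {m m0 u Hu ex} -[//|m] /andP[m0 /asboolP[u Hu]] mmin.
      have [t tu] := divD u m; exists t => z s Hz.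
      have zE := divz_eq z m.+1.
      set q := (z %/ m.+1)%Z in zE; set r := (z %% m.+1)%Z in zE.
      have r0 : 0 <= r by apply: modz_ge0.
      have rm : r < m.+1 by have := ltz_mod z (_ : m.+1%:Z != 0); apply.
      have Hq : H (x *~ (q * m.+1), t *~ (q * m.+1)).
        by rewrite ![q * _]mulrC !mulrzA -!pmulrn tu; exact: HMz.
      have Hr : H (x *~ r, s - t *~ (q * m.+1)).
        have -> : r = z - q * m.+1 by rewrite {1}zE addrC addKr.
        by rewrite mulrzBr; exact: HB.
      have r00 : r = 0.
        case: r r0 rm Hr {zE} => // -[//|r] _ rm Hr.
        rewrite ltz_nat in rm; suff : (m.+1 <= r.+1)%N by rewrite leqNgt rm.
        by apply: mmin; apply/asboolP; exists (s - t *~ (q * m.+1)); rewrite pmulrn.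
      by rewrite zE r00 addr0; apply: Hfun Hq; rewrite -[q * _]addr0 -r00 -zE.
    exists 0 => z s Hz; rewrite mul0rz.
    case: z Hz => [[|n]|n] Hz.
    - by apply: H0; rewrite mulr0z in Hz.
    - by case: none; exists n.+1 => //; exists s; rewrite pmulrn.
    - case: none; exists n.+1 => //; exists (- s).
      by have := HN _ _ Hz; rewrite NegzE mulrNz opprK -pmulrn.
  pose H' : set (G * D) := [set p | exists g s z,
    H (g, s) /\ p = (g + x *~ z, s + t *~ z)].
  have HH' : H `<=` H'.
    by move=> [g s] Hgs; exists g, s, 0; rewrite !mulr0z !addr0.
  apply: (Hmax H').
    split => // H'H; apply: nx; exists t; apply: H'H.
    by exists 0, 0, 1; rewrite !mulr1z !add0r.
  split.
  - by move=> q _ q' /HG/HH'.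
  - move=> _ _ _ _ [g [s [z [Hg [-> ->]]]]] [h [u [w [Hh [-> ->]]]]].
    exists (g - h), (s - u), (z - w); split; first exact: HB.
    by rewrite !mulrzBr !opprD; congr (_, _); rewrite addrACA.
  - move=> _ [g [s [z [Hg [/esym/eqP + ->]]]]].
    rewrite addr_eq0 => /eqP gE; have := ht (- z) s.
    by rewrite !mulrNz -gE => /(_ Hg) ->; rewrite addNr.
have [Psi hPsi] := choice Htot.
exists Psi; split=> [x y|x Bx].
  exact: Hfun (hPsi _) (HD _ _ _ _ (hPsi x) (hPsi y)).
by apply: Hfun (hPsi _) _; apply: HG; split.
Qed.
End DivisibleExtension.

(** * Properness of the quotient map by a compact subgroup *)

Section CompactSubgroup.
Variables (A : topologicalZmodType) (K : subgroup A).
Hypothesis cK : compact (sg_set K).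
Local Notation Q := (quot K).
Implicit Types (c : dual A).

Lemma nbhs0_add (U : set A) : nbhs (0 : A) U ->
  exists2 V, nbhs (0 : A) V & forall x y, V x -> V y -> U (x + y).
Proof.
move=> U0; have : nbhs ((0, 0) : A * A) [set p | U (p.1 + p.2)].
  by apply: (@add_continuous A (0, 0)); rewrite /= addr0.
case=> -[V1 V2] /= [h1 h2] h; exists (V1 `&` V2); first exact: filterI.
by move=> x y [V1x _] [_ V2y]; exact: (h (x, y)).
Qed.

Lemma nbhs_addl (a : A) (U : set A) : nbhs (0 : A) U -> nbhs a [set x | U (x - a)].
Proof.
move=> U0; apply: (@translation_continuous A (- a) a).
by rewrite subrr.
Qed.

Lemma nbhs_addr (a : A) (U : set A) : nbhs a U -> nbhs (0 : A) [set x | U (x + a)].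
Proof. by move=> U0; apply: (@translation_continuous A a 0); rewrite add0r. Qed.

                                                                         
                                          
(** A cluster point [proj a] of the projected filter lifts: the translations in [K] needed to bring
    [a] close to the sets of [F] accumulate at some [k] by compactness, and [a + k] is a cluster
    point of [F]. *)
Lemma proj_preimage_compact (D : set Q) : compact D -> compact (@proj A K @^-1` D).
Proof.
move=> cD F FF FD.
have [q [Dq clq]] : D `&` cluster (@proj A K @ F) !=set0 by apply: cD.
have [a qa] := proj_surj q; subst q.
(* [B (N, S)] collects the [k] in [K] for which [a + k + N] meets [S]. These sets are nonempty
   because [proj a] is a cluster point. *)
pose B (NS : set A * set A) := [set k | sg_set K k /\
  exists2 n, NS.1 n & NS.2 (a + k + n)].
pose H := filter_from [set NS : set A * set A | nbhs (0 : A) NS.1 /\ F NS.2] B.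
have HF : ProperFilter H.
  apply: filter_from_proper.
    apply: filter_from_filter.
      by exists (setT, setT); split; exact: filterT.
    move=> [N1 S1] [N2 S2] [/= n1 s1] [/= n2 s2].
    exists (N1 `&` N2, S1 `&` S2); first by split; exact: filterI.
    by move=> k [Kk [n [/= ? ?] [? ?]]]; split; split => //; exists n.
  move=> [N S] [/= n0 FS].
  have : F (@proj A K @^-1` (@proj A K @` S)).
    by apply: filterS FS => x Sx; exists x.
  move=> /clq/(_ (nbhs_proj K (nbhs_addl a n0))) [_ [[s Ss <-] [x Nx /esym/projP Ksx]]].
  exists (s - x); split => //; exists (x - a) => //=.
  by rewrite -addrA subrKA addrC subrK.
have [k [Kk clk]] : sg_set K `&` cluster H !=set0.
  apply: cK; exists (setT, setT); first by split; exact: filterT.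
  by move=> k [].
exists (a + k); split.
  rewrite /preimage/= (_ : proj K (a + k) = proj K a)//.
  by apply/projP; rewrite addrAC subrr add0r.
move=> S U FS Uak.
have [V V0 VV] := nbhs0_add (nbhs_addr Uak).
have HS : H (B (V, S)) by exists (V, S).
have [k' [[_ [n /= Vn Sn]] /= Vk']] := clk _ _ HS (nbhs_addl k V0).
exists (a + k' + n); split => //.
have := VV _ _ Vk' Vn; rewrite /=.
suff -> : k' - k + n + (a + k) = a + k' + n by [].
by rewrite [a + k]addrC addrA [k' - k + n]addrAC subrK addrC addrA.
Qed.

(** * The dual of the quotient as the open annihilator of [K] *)

Definition ann c := forall k, sg_set K k -> ev c k = 0.

Lemma pull_char (d : dual Q) : is_char A (ev d \o @proj A K).
Proof.
split=> [x y|x] /=; first by rewrite projD evD.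
apply: continuous_comp; [exact: proj_continuous|exact: ev_continuous].
Qed.

Definition pull (d : dual Q) : dual A := mkchar (pull_char d).

Lemma pullE (d : dual Q) x : ev (pull d) x = ev d (proj K x). Proof. by []. Qed.

Definition push_fun c (q : Q) : T := ev c (repr (q : quot_car K)).

Lemma push_funE c x : ann c -> push_fun c (proj K x) = ev c x.
Proof.
move=> hc; rewrite /push_fun -[X in ev c X](subrK x) evD hc ?add0r//.
exact: repr_pi.
Qed.

Lemma push_char c : ann c -> is_char Q (push_fun c).
Proof.
move=> hc; split=> [p q|].
  have [x ->] := proj_surj p; have [y ->] := proj_surj q.
  by rewrite -projD !push_funE// evD.
apply/(@quotient_continuous A (quot_car K)).
rewrite (_ : _ \o _ = ev c); first exact: ev_continuous.
by apply/funext => x /=; exact: push_funE.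
Qed.

(** Made total by the default [dzero Q] outside the annihilator, so that continuity and images can
    be stated on [dual A]. *)
Definition push c : dual Q :=
  if pselect (ann c) is left h then mkchar (push_char h) else dzero Q.

Lemma pushE c x : ann c -> ev (push c) (proj K x) = ev c x.
Proof. by move=> hc; rewrite /push; case: pselect => // ?; rewrite mkcharE push_funE. Qed.

Lemma ann_pull (d : dual Q) : ann (pull d).
Proof. by move=> k /proj_eq0 hk; rewrite pullE hk ev0. Qed.

Lemma pullK (d : dual Q) : push (pull d) = d.
Proof.
apply: ev_inj => q; have [x ->] := proj_surj q.
by rewrite pushE//; exact: ann_pull.
Qed.

Lemma pushK c : ann c -> pull (push c) = c.
Proof. by move=> hc; apply: ev_inj => x; rewrite pullE pushE. Qed.

(** Characters uniformly within 1/2 of [c] on the compact group [K] differ from [c] there by a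
    homomorphism whose image contains only short chords, hence by 0. In particular the annihilator
    is open. *)
Lemma agree_nbhs c : nbhs c [set d | forall k, sg_set K k -> ev d k = ev c k].
Proof.
have half : 0 < 2^-1 :> R by rewrite invr_gt0.
have /dual_cvgP/(_ (sg_set K) 2^-1 cK half) : nbhs c --> c by [].
apply: filterS => d hd k Kk; apply/eqP; rewrite -subr_eq0; apply/eqP.
have KM n : sg_set K (k *+ n).
  by elim: n => [|n IH]; rewrite ?mulrS; [exact: sg_0|exact: sg_add].
apply: no_small_subgroup => n; have := hd _ (KM n); rewrite -!dsubE.
suff -> : ev (dsub d c) (k *+ n) = ev (dsub d c) k *+ n by move/ltW.
by elim: n => [|n IH]; rewrite ?mulr0n ?ev0// !mulrS evD IH.
Qed.

Lemma agree_closed c : closed [set d | forall k, sg_set K k -> ev d k = ev c k].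
Proof.
rewrite -openC openE => d nd; rewrite /interior.
apply: filterS (agree_nbhs d) => d' h h'; apply: nd => k Kk.
by rewrite -h// h'.
Qed.

(** Uniform closeness on a compact set of [Q] is closeness on its compact preimage, and characters
    near [c] still annihilate [K]. *)
Lemma push_continuous c : ann c -> {for c, continuous push}.
Proof.
move=> hc; apply/(@dual_cvgP Q (push c) _ (fmap_filter _ (nbhs_filter c))) => D e cD e0.
have /dual_cvgP/(_ _ e (proj_preimage_compact cD) e0) h1 : nbhs c --> c by [].
apply: filterS2 h1 (agree_nbhs c) => d /= h1 h2 q Dq.
have [x qx] := proj_surj q; subst q.
rewrite !pushE//; first exact: h1.
by move=> k Kk; rewrite h2// hc.
Qed.

Lemma pull_continuous : continuous pull.
Proof.
move=> d; apply/(@dual_cvgP A (pull d) _ (fmap_filter _ (nbhs_filter d))) => C e cC e0.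
have cpC : compact (@proj A K @` C).
  by apply: continuous_compact => //; apply: continuous_subspaceT; exact: proj_continuous.
have /dual_cvgP/(_ _ e cpC e0) h1 : nbhs d --> d by [].
by apply: filterS h1 => d' /= h x Cx; rewrite !pullE; apply: h; exists x.
Qed.

                                                                              
             
(** The cosets of the annihilator are open and closed, so [C] meets finitely many of them in compact
    pieces; each piece, translated into the annihilator, is pushed to a compact set of [dual Q]. *)
Lemma compact_dual_cover (C : set (dual A)) : compact C ->
  exists (s : seq (dual A)) (D : set (dual Q)), compact D /\
    forall c, C c -> exists2 i, i \in s & exists2 d, D d &
      forall x, ev c x = ev i x + ev d (proj K x).
Proof.
move=> cC.
(* Finite lists ordered by inclusion: the near-covering form of compactness along this filter yields
   a finite subcover. *)
pose F : set_system (seq (dual A)) :=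
  filter_from setT (fun s0 : seq (dual A) => [set s : seq (dual A) | {subset s0 <= s}]).
have FF : Filter F.
  apply: filter_from_filter; first by exists [::].
  move=> s1 s2 _ _; exists (s1 ++ s2) => // s h; split=> c cs; apply: h.
    by rewrite mem_cat cs.
  by rewrite mem_cat cs orbT.
have /compact_near_coveringP cov := cC.
pose agree (s : seq (dual A)) (c : dual A) :=
  exists2 i, i \in s & forall k, sg_set K k -> ev c k = ev i k.
have [s _ /(_ s) hs] : \forall s \near F, C `<=` agree s.
  apply: (cov _ F agree) => c Cc.
  exists ([set d | forall k, sg_set K k -> ev d k = ev c k], [set s : seq (dual A) | c \in s]).
    split => /=; first exact: agree_nbhs.
    by exists [:: c] => // s h; apply: h; rewrite inE.
  by move=> [d s] /= [h1 h2]; exists c.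
have {}hs := hs (fun _ x => x).
have [D [cD hD]] : exists D : set (dual Q), compact D /\ forall i c, i \in s -> C c ->
    (forall k, sg_set K k -> ev c k = ev i k) -> exists2 d, D d &
      forall x, ev c x = ev i x + ev d (proj K x).
  elim: s {hs} => [|i s [D [cD hD]]]; first by exists set0; split => //; exact: compact0.
  pose S := C `&` [set d | forall k, sg_set K k -> ev d k = ev i k].
  pose f c := dsub c i.
  have annS c : S c -> ann (f c).
    by move=> [_ h] k Kk; rewrite dsubE h// subrr.
  exists (D `|` push @` (f @` S)); split.
    apply: compactU => //; apply: continuous_compact.
      apply: continuous_in_subspaceT => c /set_mem [d Sd <-].
      by apply: push_continuous; exact: annS.
    apply: continuous_compact.
      by apply: continuous_subspaceT; exact: dsub_continuous.
    by apply: compact_closedI => //; exact: agree_closed.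
  move=> j c; rewrite inE => /orP[/eqP ->|js] Cc h.
    exists (push (f c)); first by right; exists (f c) => //; exists c.
    by move=> x; rewrite pushE; [rewrite dsubE addrC subrK|exact: annS].
  by have [d Dd hd] := hD _ _ js Cc h; exists d => //; left.
exists s, D; split => // c Cc; have [i si h] := hs _ Cc.
by exists i => //; exact: hD.
Qed.

(** * Kronecker approximation on the dual and evaluation at points of [K] *)

Definition dual_additive (tau : dual A -> T) := forall c1 c2 c3,
  (forall x, ev c3 x = ev c1 x + ev c2 x) -> tau c3 = tau c1 + tau c2.

(** The relations are the differences of bounded integer combinations of [s] that annihilate [K].
    They are fixed before [tau], which [polars_quot] needs in order to choose one polar for all
    points. *)
Lemma dual_kronecker (s : seq (dual A)) (e : R) : 0 < e ->
  exists2 rels : seq (dual A), (forall r, r \in rels -> ann r) &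
    forall tau, dual_additive tau -> (forall r, r \in rels -> nu (tau r) <= 2^-1) ->
      exists2 k, sg_set K k & forall c, c \in s -> nu (ev c k - tau c) < e.
Proof.
move=> e0; pose I := 'I_(size s).+1.
(* The zero character is prepended to serve as the reference index [o] of [kronecker]. *)
pose ch (i : I) : dual A := nth (dzero A) (dzero A :: s) i.
have chD i x y : ev (ch i) (x + y) = ev (ch i) x + ev (ch i) y by exact: evD.
have ch0 x : ev (ch ord0) x = 0 by [].
have [N hN] := @kronecker R A T ee eeD normc_ee ee_inj (sg_set K) (sg_0 K)
  (@sg_add A K) I ord0 (fun i => ev (ch i)) chD ch0 e e0.
pose P := {ffun I -> 'I_N}.
pose dmul c n := iter n (dadd c) (dzero A).
pose dcomb (p : P) := \big[@dadd A/dzero A]_i dmul (ch i) (p i).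
have tau_dcomb (tau : dual A -> T) : tau (dzero A) = 0 ->
    (forall c d, tau (dadd c d) = tau c + tau d) ->
    forall p, tau (dcomb p) = comb (fun i => tau (ch i)) p.
  move=> t0 tD p; rewrite /dcomb (big_morph tau tD t0); apply: eq_bigr => i _.
  by elim: (nat_of_ord (p i)) => [|n IH]; rewrite ?mulr0n//= tD IH mulrS.
pose rel (pq : P * P) := dsub (dcomb pq.1) (dcomb pq.2).
exists [seq rel pq | pq <- enum {: P * P} & `[< ann (rel pq) >]].
  by move=> r /mapP[pq]; rewrite mem_filter => /andP[/asboolP h _] ->.
move=> tau tauD htau.
have tdD c d : tau (dadd c d) = tau c + tau d by apply: tauD.
have td0 : tau (dzero A) = 0.
  apply: (addIr (tau (dzero A))); rewrite add0r; apply/esym/tauD => x.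
  by rewrite addr0.
have [||k Kk hk] := hN (fun i => tau (ch i)).
- exact: td0.
- move=> p q hpq.
  have hrel : ann (rel (p, q)).
    move=> k Kk; rewrite dsubE /= (tau_dcomb (fun c => ev c k))//.
    by rewrite (tau_dcomb (fun c => ev c k))// hpq// subrr.
  have -> : comb (fun i => tau (ch i)) p - comb (fun i => tau (ch i)) q = tau (rel (p, q)).
    rewrite -!tau_dcomb//; apply/eqP; rewrite subr_eq; apply/eqP.
    by apply: tauD => x; rewrite dsubE subrK.
  apply: htau; apply/mapP; exists (p, q) => //.
  by rewrite mem_filter mem_enum andbT; apply/asboolP.
exists k => // c cs.
have ilt : ((index c s).+1 < (size s).+1)%N by rewrite ltnS index_mem.
by have := hk (Ordinal ilt); rewrite /ch /= nth_index.
Qed.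

(** Approximate solutions for finite lists form a filter on [K]; a cluster point solves all the
    equations exactly. The set [Z] keeps track of where the approximations lie. *)
Lemma compact_eval (Z : set A) (tau : dual A -> T) :
  (forall (s : seq (dual A)) (e : R), 0 < e -> exists k,
    [/\ sg_set K k, Z k & forall c, c \in s -> nu (ev c k - tau c) < e]) ->
  exists k, [/\ sg_set K k, closure Z k & forall c, ev c k = tau c].
Proof.
move=> h.
pose B (se : seq (dual A) * R) := [set k | [/\ sg_set K k, Z k &
  forall c, c \in se.1 -> nu (ev c k - tau c) < se.2]].
pose F := filter_from [set se : seq (dual A) * R | 0 < se.2] B.
have FF : ProperFilter F.
  apply: filter_from_proper; last by move=> [s e] /= /h; exact.
  apply: filter_from_filter; first by exists ([::], 1) => /=.
  move=> [s1 e1] [s2 e2] /= e10 e20; exists (s1 ++ s2, Num.min e1 e2).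
    by rewrite /= lt_min e10.
  move=> k [/= Kk Zk hk]; split; split => //= c cs.
    by have := hk c; rewrite mem_cat cs lt_min => /(_ isT)/andP[].
  by have := hk c; rewrite mem_cat cs orbT lt_min => /(_ isT)/andP[].
have FB s e : 0 < e -> F (B (s, e)) by move=> e0; exists (s, e).
have [k [Kk clk]] : sg_set K `&` cluster F !=set0.
  by apply: cK; exists ([::], 1) => //= k [].
exists k; split => //.
  move=> U Uk; have F1 : F Z by exists ([::], 1) => //= x [].
  exact: clk.
move=> c; apply/eqP; rewrite -subr_eq0; apply/eqP; apply: nu_small_eq0 => e e0.
have e2 : 0 < e / 2 by lra.
have /Tcirc_continuousP/(_ _ e2) hU := @ev_continuous A c k.
have [k' [[_ _ /(_ c)] /= + h2]] := clk _ _ (FB [:: c] _ e2) hU.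
rewrite inE eqxx => /(_ isT) h1.
apply: le_lt_trans (nu_triangle _ (ev c k') _) _.
by rewrite nuC; lra.
Qed.

                                                                            
                                                               
(** All relations supplied by [dual_kronecker] lie in the annihilator, where [tau] vanishes, so
    [tau] is approximated on every finite list. No continuity of [tau] is assumed: algebraic
    information determines a point of [K]. *)
Lemma ann_eval (tau : dual A -> T) : dual_additive tau ->
  (forall c, ann c -> tau c = 0) ->
  exists2 k, sg_set K k & forall c, ev c k = tau c.
Proof.
move=> tauD tau0.
have [s e e0|k [Kk _ hk]] := @compact_eval setT tau; last by exists k.
have [rels hrels hk] := dual_kronecker s e0.
have [|k Kk h] := hk tau tauD; last by exists k.
by move=> r /hrels/tau0 ->; rewrite nu0 invr_ge0.
Qed.

(** * Injectivity and surjectivity of [alpha] for the quotient *)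

Hypothesis alpha_inj : injective (alpha A).

Lemma ev_separates x y : (forall c, ev c x = ev c y) -> x = y.
Proof. by move=> h; apply: alpha_inj; apply/funext => c; exact: h. Qed.

(** If [x] and [y] agree on the annihilator, evaluation at [x - y] vanishes there, so it is
    evaluation at some [k] in [K]; points being separated, [x - y = k]. *)
Lemma alpha_quot_inj : injective (alpha Q).
Proof.
move=> p q; have [x ->] := proj_surj p; have [y ->] := proj_surj q => h.
have [||k Kk hk] := @ann_eval (fun c => ev c (x - y)).
- by move=> c1 c2 c3; exact.
- move=> c hc; rewrite evB -!(pushE _ hc).
  by have := congr1 (fun f => f (push c)) h; rewrite /alpha -!/(ev _ _) => ->; rewrite subrr.
- by apply/projP; rewrite -(ev_separates hk).
Qed.

(** [Psi] restricted to the annihilator is evaluation at some [a]; the difference with evaluation at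
    [a] is evaluation at some [k] in [K], so [Psi] is evaluation at [k + a]. *)
Lemma alpha_surj_of_quot : alpha_surjective Q -> alpha_surjective A.
Proof.
move=> sQ Psi [PsiD Psic].
have [|q _ hq] := sQ (Psi \o pull).
  split=> [c1 c2 c3 h|d] /=.
    by apply: PsiD => x; exact: h.
  by apply: continuous_comp; [exact: pull_continuous|exact: Psic].
have [a qa] := proj_surj q; subst q.
have hPsi (d : dual Q) : Psi (pull d) = ev d (proj K a).
  by rewrite -[LHS]/((Psi \o pull) d) -hq.
have [||k Kk hk] := @ann_eval (fun c => Psi c - ev c a).
- by move=> c1 c2 c3 h; rewrite (PsiD c1 c2)// h opprD addrACA.
- by move=> c hc; rewrite -(pushK hc) hPsi pullE subrr.
- exists (k + a) => //; apply/funext => c.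
  by rewrite /alpha -/(ev c _) evD hk subrK.
Qed.

(** [psi] is a homomorphism on the annihilator. Any algebraic extension is continuous on the dual of
    [A], being continuous on an open subgroup, and a point representing it projects to one
    representing [psi]. *)
Lemma alpha_quot_surj : alpha_surjective A -> alpha_surjective Q.
Proof.
move=> sA psi [psiD psic].
pose toD (f : A -> T) : dual A :=
  if pselect (is_char A f) is left h then mkchar h else dzero A.
have toDE f : is_char A f -> forall x, ev (toD f) x = f x.
  by rewrite /toD => hf x; case: pselect.
have toDK c : toD (ev c) = c.
  by apply: ev_inj => x; rewrite toDE//; exact: ev_char.
(* The extension takes place in the group of all functions [A -> T], which has its pointwise group
   structure at hand; [toD] turns those that are characters back into elements of [dual A]. *)
pose B : set (A -> T) := [set f | is_char A f /\ ann (toD f)].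
have BB f g : B f -> B g -> B (f - g).
  move=> [cf af] [cg ag]; have cfg : is_char A (f - g) by exact: is_charB.
  split => // k Kk; rewrite toDE// -[LHS]/(f k - g k).
  by rewrite -(toDE f)// -(toDE g)// af// ag// subrr.
have [|||Psi [PsiD PsiB]] := @divisible_extension (A -> T) T Tcirc_divisible B
  (fun f => psi (push (toD f))).
- have c0 : is_char A (0 : A -> T) by exact: is_char0.
  by split => // k Kk; rewrite toDE.
- exact: BB.
- move=> f g Bf Bg; apply/eqP; rewrite eq_sym subr_eq eq_sym; apply/eqP.
  apply/esym/psiD => q; have [x ->] := proj_surj q.
  have [[cf af] [cg ag] [cfg afg]] := And3 Bf Bg (BB _ _ Bf Bg).
  rewrite -!/(ev _ _) !pushE// !toDE//.
  by rewrite -[(f - g) x]/(f x - g x) subrK.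
have PsiE c : ann c -> Psi (ev c) = psi (push c).
  move=> hc; rewrite PsiB ?toDK//; split; first exact: ev_char.
  by rewrite toDK.
have [|a _ ha] := sA (fun c => Psi (ev c)).
  split=> [c1 c2 c3 h|c].
    rewrite -PsiD; congr Psi; apply/funext => x; exact: h.
  apply/Tcirc_continuousP => e e0.
  (* Near [c], the difference [dsub d c] annihilates [K], and there the extension is given by the
     continuous [psi]. *)
  have cc : {for c, continuous (psi \o push \o (fun d => dsub d c))}.
    apply: continuous_comp; first exact: dsub_continuous.
    apply: continuous_comp; last exact: psic.
    by apply: push_continuous => k Kk; rewrite dsubE subrr.
  move/Tcirc_continuousP: cc => /(_ e e0) cc.
  apply: filterS2 cc (agree_nbhs c) => d /= h1 h2.
  have ad : ann (dsub d c) by move=> k Kk; rewrite dsubE h2// subrr.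
  have ac : ann (dsub c c) by move=> k Kk; rewrite dsubE subrr.
  move: h1; rewrite -!PsiE//.
  have -> : Psi (ev (dsub c c)) = 0.
    apply: (addIr (Psi (ev (dsub c c)))); rewrite add0r -PsiD; congr Psi.
    by apply/funext => x; rewrite -[LHS]/(ev (dsub c c) x + ev (dsub c c) x) dsubE subrr addr0.
  rewrite subr0; suff -> : Psi (ev d) = Psi (ev (dsub d c)) + Psi (ev c) by rewrite addrK.
  rewrite -PsiD; congr Psi; apply/funext => x.
  by rewrite -[RHS]/(ev (dsub d c) x + ev c x) dsubE subrK.
exists (proj K a) => //; apply/funext => d.
have := congr1 (fun f => f (pull d)) ha.
by rewrite PsiE ?pullK//; exact: ann_pull.
Qed.

(** * Equicontinuity and polars: transfer between [A] and the quotient *)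

Lemma nbhs0_nu_seq (s : seq (dual A)) (e : R) : 0 < e ->
  \forall x \near (0 : A), forall c, c \in s -> nu (ev c x) < e.
Proof.
move=> e0; elim: s => [|c s IH]; first by apply: nearW.
have /Tcirc_continuousP/(_ e e0) hc := @ev_continuous A c 0.
apply: filterS2 hc IH => x; rewrite ev0 subr0 => h1 h2 d.
by rewrite inE => /orP[/eqP ->//|]; exact: h2.
Qed.

Lemma seq_compact (Y : topologicalType) (s : seq Y) : compact [set y | y \in s].
Proof. by apply: finite_compact; apply/finite_seqP; exists s. Qed.

Lemma equicontinuous_quot : equicontinuous_duals A -> equicontinuous_duals Q.
Proof.
move=> h D e cD e0.
have cP : compact (pull @` D).
  by apply: continuous_compact => //; apply: continuous_subspaceT; exact: pull_continuous.
have := nbhs_proj K (h _ e cP e0); rewrite proj0.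
apply: filterS => _ [x hx <-] d Dd; rewrite -pullE; apply: hx.
by exists d.
Qed.

(** Each character of [C] is one of finitely many, small near 0 by continuity, plus one pulled back
    from a compact set [D] of [dual Q]; each summand gets [e / 2]. *)
Lemma equicontinuous_of_quot : equicontinuous_duals Q -> equicontinuous_duals A.
Proof.
move=> h C e cC e0; have e2 : 0 < e / 2 by lra.
have [s [D [cD hD]]] := compact_dual_cover cC.
have hq : nbhs (0 : A) [set x | forall d : dual Q, D d -> nu (ev d (proj K x)) < e / 2].
  exact: (@proj_continuous A K 0 _ (h D (e / 2) cD e2)).
apply: filterS2 hq (nbhs0_nu_seq s e2) => x h1 h2 c Cc.
have [i si [d Dd ->]] := hD _ Cc.
by apply: le_lt_trans (nuD _ _) _; have := h1 _ Dd; have := h2 _ si; lra.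
Qed.

(** A polar in [Q] places [a] in [v + K] with [v] small, and finitely many further characters of [A]
    make the difference [a - v] in [K] small. *)
Lemma polars_of_quot : polars_nbhs_base Q -> polars_nbhs_base A.
Proof.
move=> h U U0; have [V V0 VV] := nbhs0_add U0.
(* Were there no such list, [compact_eval] would give a [k] in [K], in the closure of the complement
   of [V], killed by all characters; then [k = 0], which is interior to [V]. *)
have [s [e [e0 hs]]] : exists (s : seq (dual A)) (e : R), 0 < e /\
    forall k, sg_set K k -> (forall c, c \in s -> nu (ev c k) < e) -> V k.
  apply: contrapT => no.
  have [s e e0|k [Kk clk hk]] := @compact_eval (~` V) (fun=> 0).
    apply: contrapT => no'; apply: no; exists s, e; split => // k Kk hk.
    apply: contrapT => nV; apply: no'; exists k; split => // c cs.
    by rewrite subr0 hk.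
  have k0 : k = 0 by apply: ev_separates => c; rewrite hk ev0.
  by rewrite k0 in clk; have [x []] := clk V V0.
have e2 : 0 < e / 2 by lra.
pose V1 := V `&` [set x | forall c, c \in s -> nu (ev c x) < e / 2].
have V10 : nbhs (0 : A) V1 by apply: filterI => //; exact: nbhs0_nu_seq.
have [D [e1 [cD e10 hD]]] := h _ (nbhs_proj K V10).
exists (pull @` D `|` [set c | c \in s]), (Num.min e1 (e / 2)); split.
- apply: compactU; last exact: seq_compact.
  by apply: continuous_compact => //; apply: continuous_subspaceT; exact: pull_continuous.
- by rewrite lt_min e10.
- move=> a ha; have [v [Vv hv] /esym/projP Kav] : (@proj A K @` V1) (proj K a).
    apply: hD => d Dd; have := ha (pull d); rewrite pullE lt_min.
    by move=> /(_ (or_introl _))/andP[]//; exists d.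
  rewrite -(subrK v a); apply: VV => //; apply: hs => // c cs.
  have := ha c (or_intror cs); rewrite lt_min => /andP[_ hca].
  by rewrite evB; apply: le_lt_trans (nuB _ _) _; have := hv _ cs; lra.
Qed.

(** A point [a] whose class lies in the polar found in [Q] need not lie in the polar of [C];
    Kronecker approximation moves it there by an element of [K], without changing its class. *)
Lemma polars_quot : polars_nbhs_base A -> polars_nbhs_base Q.
Proof.
move=> h U U0.
have [C [e [cC e0 hC]]] := h _ (@proj_continuous A K 0 _ U0).
have e2 : 0 < e / 2 by lra.
have [s [D [cD hD]]] := compact_dual_cover cC.
have [rels hrels hk] := dual_kronecker s e2.
exists (D `|` [set d | d \in map push rels]), (Num.min (e / 2) 2^-1); split.
- by apply: compactU => //; exact: seq_compact.
- by rewrite lt_min e2/= invr_gt0.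
- move=> q; have [a ->] := proj_surj q => ha.
  (* Taking [tau] to be evaluation at [- a] makes [k] nearly cancel [a] on [s]; the tolerance [2^-1]
     on [map push rels] is what the relations require. *)
  have [|r rr|k Kk hka] := hk (fun c => ev c (- a)).
  + by move=> c1 c2 c3; exact.
  + rewrite evN nuN -(pushE a (hrels _ rr)).
    have /ha : (D `|` [set d | d \in map push rels]) (push r) by right; exact: map_f.
    by rewrite lt_min => /andP[_ /ltW].
  have E : proj K (a + k) = proj K a by apply/projP; rewrite addrAC subrr add0r.
  have : (@proj A K @^-1` U) (a + k).
    apply: hC => c Cc; have [i si [d Dd ->]] := hD _ Cc; rewrite E.
    apply: le_lt_trans (nuD _ _) _.
    have := ha d (or_introl Dd); rewrite lt_min => /andP[h1 _].
    have := hka i si; rewrite evN opprK [_ + ev i a]addrC -evD; lra.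
  by rewrite /preimage/= E.
Qed.
End CompactSubgroup.

Theorem mainTheorem19 (A : topologicalZmodType) (K : subgroup A) :
  hausdorff_space A ->
  injective (alpha A) ->
  compact (sg_set K) ->
  [/\ injective (alpha (quot K)),
      (alpha_surjective (quot K) <-> alpha_surjective A)
    & (alpha_topiso (quot K) <-> alpha_topiso A)].
Proof.
move=> _ inj cK.
have injQ : injective (alpha (quot K)) by exact: alpha_quot_inj.
have surj : alpha_surjective (quot K) <-> alpha_surjective A.
  by split; [exact: alpha_surj_of_quot|exact: alpha_quot_surj].
split => //.
have -> := alpha_topisoP (@quot_translation_continuous A K).
have -> := alpha_topisoP (@translation_continuous A).
split=> [[_ s e p]|[_ s e p]]; split => //.
- exact/surj.
- exact: equicontinuous_of_quot e.
- exact: polars_of_quot p.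
- exact/surj.
- exact: equicontinuous_quot e.
- exact: polars_quot p.
Qed.
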